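(* Let $$L(\lambda)=\lambda L_1-L_0=\begin{bmatrix} \lambda A_1-A_0 & B_0-\lambda B_1\\ \lambda C_1-C_0 & \lambda D_1-D_0\end{bmatrix}$$ be a linear system matrix, with $\lambda A_1-A_0$ a regular $d\times d$ complex pencil, $B_0,B_1\in\mathbb{C}^{d\times n}$, $C_0,C_1\in\mathbb{C}^{m\times d}$, $D_0,D_1\in\mathbb{C}^{m\times n}$. If $L(\lambda)$ is strongly minimal, then $L(\lambda)$ is strongly irreducible.
   Context: A square pencil is regular if its determinant is not identically zero. The normal rank of a rational matrix is the size of its largest minor that is not identically zero. Strongly minimal: $L(\lambda)$ is strongly minimal if the two pencils $$\begin{bmatrix} \lambda A_1-A_0 & B_0-\lambda B_1\end{bmatrix},\qquad \begin{bmatrix} \lambda A_1-A_0\\ \lambda C_1-C_0\end{bmatrix}$$ have no finite or infinite eigenvalues (they are considered as polynomial matrices of grade $1$, the degree of the linear system matrix). Here $\lambda_0\in\mathbb{C}$ is a finite eigenvalue of a (possibly rectangular) pencil $P(\lambda)=\lambda P_1-P_0$ if $\operatorname{rank}P(\lambda_0)$ is smaller than the normal rank of $P$; $P$ has an infinite eigenvalue if $0$ is an eigenvalue of $\lambda P(1/\lambda)=P_1-\lambda P_0$, i.e. if $\operatorname{rank}P_1$ is smaller than the normal rank of $P$. Strongly irreducible: $L(\lambda)$ is strongly irreducible if the two pencils $$\begin{bmatrix} \lambda A_1-A_0 & B_0-\lambda B_1 & 0\\ \lambda C_1-C_0 & \lambda D_1-D_0 & -I_m\end{bmatrix},\qquad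 \begin{bmatrix} \lambda A_1-A_0 & B_0-\lambda B_1\\ \lambda C_1-C_0 & \lambda D_1-D_0\\ 0 & I_n\end{bmatrix}$$ have no finite or infinite zeros. Zeros (McMillan sense): for a $p\times q$ rational matrix $R(\lambda)$ of normal rank $r$ and a point $\lambda_0\in\mathbb{C}\cup\{\infty\}$, there are rational matrices $M_\ell,M_r$, regular at $\lambda_0$ (bounded and invertible there), such that $M_\ell RM_r$ has leading $r\times r$ block $\mathrm{diag}((\lambda-\lambda_0)^{d_1},\dots,(\lambda-\lambda_0)^{d_r})$, $d_1\le\dots\le d_r$, and zeros elsewhere; if $\lambda_0=\infty$, the factor $\lambda-\lambda_0$ is replaced by $1/\lambda$. The uniquely determined integers $d_i$ are the structural indices of $R$ at $\lambda_0$; $R$ has a zero at $\lambda_0$ if some $d_i>0$. Pencils are viewed as rational matrices. *)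

(* Defs.v *)
From mathcomp Require Import all_boot all_order all_algebra.
From mathcomp Require Import complex.
From mathcomp Require Import reals.
Set Implicit Arguments.
Unset Strict Implicit.
Unset Printing Implicit Defensive.
Import Order.TTheory GRing.Theory Num.Theory.
Local Open Scope ring_scope.

(* \lambda P1 - P0, with \lambda the polynomial variable 'X *)
Definition pencil (F : fieldType) p q (P1 P0 : 'M[F]_(p, q)) :
    'M[{poly F}]_(p, q) :=
  'X *: map_mx polyC P1 - map_mx polyC P0.

Definition regular_pencil (F : fieldType) d (P : 'M[{poly F}]_d) : Prop :=
  \det P != 0.

(* Size of the largest nonzero minor.  The selections f of rows and g of
   columns are not required to be increasing: a repetition makes the
   determinant vanish and a reordering only changes its sign. *)
Definition normal_rank (R : comNzRingType) p q (M : 'M[R]_(p, q)) : nat :=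
  \max_(k < (minn p q).+1 |
      [exists f : {ffun 'I_k -> 'I_p}, [exists g : {ffun 'I_k -> 'I_q},
        \det (mxsub f g M) != 0]]) k.

Definition finite_eigenvalue (F : fieldType) p q
    (P : 'M[{poly F}]_(p, q)) (x : F) : Prop :=
  (\rank (map_mx (horner_eval x) P) < normal_rank P)%N.

(* \lambda P(1/\lambda), for P of grade 1 *)
Definition reversal1 (F : fieldType) p q (P : 'M[{poly F}]_(p, q)) :
    'M[{poly F}]_(p, q) :=
  map_mx (fun a : {poly F} => (a`_1)%:P + a`_0 *: 'X) P.

Definition infinite_eigenvalue (F : fieldType) p q
    (P : 'M[{poly F}]_(p, q)) : Prop :=
  finite_eigenvalue (reversal1 P) 0.

Definition no_eigenvalues (F : fieldType) p q
    (P : 'M[{poly F}]_(p, q)) : Prop :=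
  (forall x, ~ finite_eigenvalue P x) /\ ~ infinite_eigenvalue P.

Inductive point (F : Type) : Type := FinitePoint of F | InfinitePoint.
Arguments InfinitePoint {F}.

Definition to_rational (F : fieldType) p q (P : 'M[{poly F}]_(p, q)) :
    'M[{fraction {poly F}}]_(p, q) :=
  map_mx (@tofrac {poly F}) P.

(* The rational function f is bounded at x, with value v there.  At infinity
   this says that deg a <= deg b in f = a / b, and v is the limit: the
   coefficient of degree deg b of a over the leading coefficient of b. *)
Definition has_value (F : fieldType) (x : point F)
    (f : {fraction {poly F}}) (v : F) : Prop :=
  exists a b : {poly F},
    f = tofrac a / tofrac b /\
    match x with
    | FinitePoint z => b.[z] != 0 /\ v = a.[z] / b.[z]
    | InfinitePoint =>
        [/\ b != 0, (size a <= size b)%N &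
            v = a`_(size b).-1 / lead_coef b]
    end.

Definition regular_at (F : fieldType) (x : point F) p
    (M : 'M[{fraction {poly F}}]_p) : Prop :=
  exists2 V : 'M[F]_p,
    forall i j, has_value x (M i j) (V i j) & V \in unitmx.

Definition local_parameter (F : fieldType) (x : point F) :
    {fraction {poly F}} :=
  match x with
  | FinitePoint z => tofrac ('X - z%:P)
  | InfinitePoint => (tofrac 'X)^-1
  end.

Definition structural_indices (F : fieldType) p q
    (M : 'M[{fraction {poly F}}]_(p, q)) (x : point F) (ds : seq int) : Prop :=
  [/\ size ds = normal_rank M,
      sorted (fun a b : int => a <= b) ds &
      exists (Ml : 'M[{fraction {poly F}}]_p)
             (Mr : 'M[{fraction {poly F}}]_q),
        [/\ regular_at x Ml, regular_at x Mr &
            Ml *m M *m Mr = \matrix_(i < p, j < q)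
              if (i == j :> nat) && (i < size ds)%N
              then local_parameter x ^ ds`_i else 0]].

Definition has_zero (F : fieldType) p q
    (M : 'M[{fraction {poly F}}]_(p, q)) (x : point F) : Prop :=
  exists ds, structural_indices M x ds /\ has (fun e : int => 0 < e) ds.

Definition no_zeros (F : fieldType) p q
    (P : 'M[{poly F}]_(p, q)) : Prop :=
  forall x : point F, ~ has_zero (to_rational P) x.

Definition linear_system_matrix (F : fieldType) d m n
    (A0 A1 : 'M[F]_d) (B0 B1 : 'M[F]_(d, n))
    (C0 C1 : 'M[F]_(m, d)) (D0 D1 : 'M[F]_(m, n)) :
    'M[{poly F}]_(d + m, d + n) :=
  block_mx (pencil A1 A0) (- pencil B1 B0)
           (pencil C1 C0) (pencil D1 D0).

Definition strongly_minimal (F : fieldType) d m n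
    (L : 'M[{poly F}]_(d + m, d + n)) : Prop :=
  no_eigenvalues (usubmx L) /\ no_eigenvalues (lsubmx L).

Definition strongly_irreducible (F : fieldType) d m n
    (L : 'M[{poly F}]_(d + m, d + n)) : Prop :=
  no_zeros (row_mx L (col_mx 0 (- 1%:M) : 'M_(d + m, m))) /\
  no_zeros (col_mx L (row_mx 0 1%:M : 'M_(n, d + n))).

(* Main.v *)
Require Import Defs.
From mathcomp Require Import all_boot all_order all_algebra.
From mathcomp Require Import complex.
From mathcomp Require Import reals.
Import GRing.Theory.
Local Open Scope ring_scope.

(** Suppose that M has a zero at a point x, so that Ml *m M *m Mr is diagonal
    with a positive power of the local parameter at place i.  Then row i of this
    product tends to 0 at x, and so does u *m M, where u is row i of Ml, because
    Mr is invertible at x.  Moreover u has a nonzero limit U, because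
    Ml is invertible at x.  In the same way, a column of Mr gives a right null
    direction ([has_zero_left_null], [has_zero_right_null]).

    Take M = [N 0; K cI], where N is the block row of L that contains the
    pencil of the A's.  Write u = (u1, u2) and U = (U1, U2).  The last block of
    u *m M is c u2, so U2 = 0.  The first block is u1 N + u2 K, and dividing it
    by lambda if x is infinite makes N and K bounded, with limits N(x) and K(x),
    which are N_1 and K_1 at infinity.  The limit is U1 N(x) = 0, hence U1 = 0
    as soon as N(x) has full row rank ([extended_no_left_null]).  That rank
    condition, at every x including infinity, is strong minimality: since
    the pencil of the A's is regular, the normal rank of N is its number of rows,
    and so is that of its reversal ([reversal1_det_neq0]).  The second extended
    pencil is the same situation transposed.

    Finite points and infinity are treated together: a polynomial of degree at
    most n is seen as a form of degree n on the projective line. *)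

(** * Values of rational functions on the projective line *)

(** The value at x of the homogenization of a in degree n, in the coordinates
    (z : 1) for a finite point z and (1 : 0) for infinity. *)
Definition homog_eval {F : fieldType} (x : point F) (n : nat)
    (a : {poly F}) : F :=
  match x with FinitePoint z => a.[z] | InfinitePoint => a`_n end.

(** The bound is only imposed at infinity, so that at a finite point every
    fraction is admissible in every degree. *)
Definition homog_bound {F : fieldType} (x : point F) (n : nat)
    (a : {poly F}) : Prop :=
  match x with FinitePoint _ => True | InfinitePoint => (size a <= n.+1)%N end.

Section Values.
Context {F : fieldType}.
Implicit Types (x : point F) (a b : {poly F}).

Lemma coefM_top a b k l : (size a <= k.+1)%N -> (size b <= l.+1)%N ->
  (a * b)`_(k + l) = a`_k * b`_l.
Proof.
move=> ha hb; have hk : (k < (k + l).+1)%N by rewrite ltnS leq_addr.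
rewrite coefM (bigD1 (Ordinal hk)) //= addKn big1 ?addr0 // => i /eqP neq_ik.
have [lt_ik | le_ki] := ltnP i k.
  by rewrite [b`__]nth_default ?mulr0 // (leq_trans hb) // ltn_subRL ltn_add2r.
rewrite [a`__]nth_default ?mul0r // (leq_trans ha) // ltn_neqAle le_ki andbT.
by apply/eqP => eq_ki; apply: neq_ik; apply: val_inj.
Qed.

Lemma homog_evalM {x k l a b} : homog_bound x k a -> homog_bound x l b ->
  homog_eval x (k + l) (a * b) = homog_eval x k a * homog_eval x l b.
Proof. by case: x => [z|] /=; [rewrite hornerM | apply: coefM_top]. Qed.

Lemma homog_boundM {x k l a b} : homog_bound x k a -> homog_bound x l b ->
  homog_bound x (k + l) (a * b).
Proof.
case: x => [z|] //= ha hb; apply: leq_trans (size_polyMleq _ _) _.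
by rewrite -subn1 leq_subLR add1n -addnS -addSn leq_add.
Qed.

Lemma homog_evalD x k a b :
  homog_eval x k (a + b) = homog_eval x k a + homog_eval x k b.
Proof. by case: x => [z|] /=; rewrite (hornerD, coefD). Qed.

Lemma homog_boundD {x k a b} :
  homog_bound x k a -> homog_bound x k b -> homog_bound x k (a + b).
Proof.
case: x => [z|] //= ha hb; apply: leq_trans (size_polyD _ _) _.
by rewrite geq_max ha.
Qed.

Lemma homog_eval_neq0 {x k b} : homog_eval x k b != 0 -> b != 0.
Proof. by apply: contraNneq => ->; case: x => [z|] /=; rewrite (horner0, coef0). Qed.

(** A value is the quotient of two forms of the same degree n, which need not
    be the degree of the denominator in lowest terms: this freedom is what makes
    the ring operations on values uniform in x. *)
Lemma has_valueP {x f v} :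
  has_value x f v <->
  exists n a b, [/\ f = tofrac a / tofrac b, homog_bound x n a,
    homog_bound x n b, homog_eval x n b != 0 &
    v = homog_eval x n a / homog_eval x n b].
Proof.
split=> [[a [b [-> ]]] | [n [a [b [-> ha hb hb0 ->]]]]]; last first.
  exists a, b; split=> //; case: x ha hb hb0 => [z|] //= ha hb hb0.
  have szb : size b = n.+1.
    by apply/eqP; rewrite eqn_leq hb ltnNge; apply: contraNN hb0 => /leq_sizeP->.
  have b0 : b != 0 by rewrite -size_poly_eq0 szb.
  by split=> //; rewrite ?lead_coefE szb.
case: x => [z [b0 ->] | [b0 hab ->]]; first by exists 0%N, a, b.
have szb : size b = (size b).-1.+1 by rewrite prednK // size_poly_gt0.
by exists (size b).-1, a, b; split; rewrite /= -?szb // -lead_coefE lead_coef_eq0.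
Qed.

Lemma has_value_unique {x f v w} : has_value x f v -> has_value x f w -> v = w.
Proof.
move=> /has_valueP[k [a [b [-> ha hb b0 ->]]]].
move=> /has_valueP[l [a' [b' [eqf ha' hb' b'0 ->]]]].
have tb0 : tofrac b != 0 by rewrite tofrac_eq0 (homog_eval_neq0 b0).
have tb'0 : tofrac b' != 0 by rewrite tofrac_eq0 (homog_eval_neq0 b'0).
move/eqP: eqf; rewrite (eqr_div _ _ tb0 tb'0) -tofracM -tofracM tofrac_eq => /eqP eq_ab.
apply/eqP; rewrite eqr_div // -(homog_evalM ha hb') -(homog_evalM ha' hb).
by rewrite eq_ab addnC.
Qed.

Lemma has_valueM {x f g v w} :
  has_value x f v -> has_value x g w -> has_value x (f * g) (v * w).
Proof.
move=> /has_valueP[k [a [b [-> ha hb b0 ->]]]].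
move=> /has_valueP[l [a' [b' [-> ha' hb' b'0 ->]]]].
apply/has_valueP; exists (k + l)%N, (a * a'), (b * b').
rewrite !homog_evalM // !mulf_div !tofracM mulf_neq0 //.
by split=> //; apply: homog_boundM.
Qed.

Lemma has_valueD {x f g v w} :
  has_value x f v -> has_value x g w -> has_value x (f + g) (v + w).
Proof.
move=> /has_valueP[k [a [b [-> ha hb b0 ->]]]].
move=> /has_valueP[l [a' [b' [-> ha' hb' b'0 ->]]]].
have tb0 : tofrac b != 0 by rewrite tofrac_eq0 (homog_eval_neq0 b0).
have tb'0 : tofrac b' != 0 by rewrite tofrac_eq0 (homog_eval_neq0 b'0).
apply/has_valueP; exists (k + l)%N, (a * b' + a' * b), (b * b').
have ha'b : homog_bound x (k + l) (a' * b).
  by rewrite addnC; apply: homog_boundM.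
have ea'b : homog_eval x (k + l) (a' * b) = homog_eval x l a' * homog_eval x k b.
  by rewrite addnC homog_evalM.
rewrite homog_evalD ea'b !homog_evalM // (addf_div _ _ tb0 tb'0).
rewrite (addf_div _ _ b0 b'0) tofracD !tofracM mulf_neq0 //.
by split=> //; [apply: homog_boundD => //; apply: homog_boundM | apply: homog_boundM].
Qed.

Lemma has_valueV {x f v} : v != 0 -> has_value x f v -> has_value x f^-1 v^-1.
Proof.
move=> v0 /has_valueP[k [a [b [-> ha hb b0 ev]]]].
apply/has_valueP; exists k, b, a; split=> //; rewrite ?ev ?invf_div //.
by apply: contraNneq v0 => a0; rewrite ev a0 mul0r.
Qed.

Lemma has_valueC x (c : F) : has_value x (tofrac c%:P) c.
Proof.
apply/has_valueP; exists 0%N, c%:P, 1; rewrite tofrac1 divr1.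
by case: x => [z|] /=; rewrite ?hornerE ?coefC ?coef1 ?divr1 ?oner_neq0 ?size_polyC
  ?leq_b1 ?size_poly1.
Qed.

Lemma has_value0 x : has_value x 0 0.
Proof. by rewrite -tofrac0 -polyC0; apply: has_valueC. Qed.

Lemma has_value1 x : has_value x 1 1.
Proof. by rewrite -tofrac1 -polyC1; apply: has_valueC. Qed.

Lemma has_value_sum {x} {I : finType} {f : I -> {fraction {poly F}}} {v : I -> F} :
  (forall i, has_value x (f i) (v i)) -> has_value x (\sum_i f i) (\sum_i v i).
Proof.
move=> h; apply: (big_ind2 (has_value x)) => // [|? ? ? ?]; first exact: has_value0.
exact: has_valueD.
Qed.

Lemma has_value_prod {x} {I : finType} {f : I -> {fraction {poly F}}} {v : I -> F} :
  (forall i, has_value x (f i) (v i)) -> has_value x (\prod_i f i) (\prod_i v i).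
Proof.
move=> h; apply: (big_ind2 (has_value x)) => // [|? ? ? ?]; first exact: has_value1.
exact: has_valueM.
Qed.

Lemma has_valueX {x f v} n : has_value x f v -> has_value x (f ^+ n) (v ^+ n).
Proof.
move=> hf; elim: n => [|n IHn]; first exact: has_value1.
by rewrite !exprS; apply: has_valueM.
Qed.

Lemma has_value_sign x n : has_value x ((-1) ^+ n) ((-1) ^+ n).
Proof.
apply: has_valueX; have := has_valueC x (-1).
by rewrite polyCN polyC1 tofracN tofrac1.
Qed.

Lemma has_value_local_parameter x : has_value x (local_parameter x) 0.
Proof.
case: x => [z|] /=.
  exists ('X - z%:P), 1.
  by rewrite tofrac1 divr1 !hornerE subrr mul0r oner_neq0.
exists 1, 'X; rewrite tofrac1 div1r; split=> //.
by rewrite polyX_eq0 size_polyX size_poly1 coef1 mul0r.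
Qed.

Lemma has_value_local_parameter_exp x (e : int) : (0 < e)%R ->
  has_value x (local_parameter x ^ e) 0.
Proof.
case: e => [[|n]|n] // _; rewrite -exprnP.
by have := has_valueX n.+1 (has_value_local_parameter x); rewrite expr0n.
Qed.

(** * Limits of rational matrices *)

Definition mx_value x {p q} (M : 'M[{fraction {poly F}}]_(p, q))
    (V : 'M[F]_(p, q)) : Prop :=
  forall i j, has_value x (M i j) (V i j).

Lemma mx_valueM {x p q r} {M : 'M_(p, q)} {N : 'M_(q, r)} {V W} :
  mx_value x M V -> mx_value x N W -> mx_value x (M *m N) (V *m W).
Proof.
by move=> hM hN i j; rewrite !mxE; apply: has_value_sum => k; apply: has_valueM.
Qed.

Lemma mx_valueZ {x p q} {c} {e : F} {M : 'M_(p, q)} {V} :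
  has_value x c e -> mx_value x M V -> mx_value x (c *: M) (e *: V).
Proof. by move=> hc hM i j; rewrite !mxE; apply: has_valueM. Qed.

Lemma mx_value_unique {x p q} {M : 'M_(p, q)} {V W} :
  mx_value x M V -> mx_value x M W -> V = W.
Proof.
by move=> hV hW; apply/matrixP => i j; apply: has_value_unique (hV i j) (hW i j).
Qed.

Lemma has_value_det {x p} {M : 'M_p} {V} :
  mx_value x M V -> has_value x (\det M) (\det V).
Proof.
move=> hM; apply: has_value_sum => s; apply: has_valueM; first exact: has_value_sign.
by apply: has_value_prod => i.
Qed.

Lemma mx_value_adj {x p} {M : 'M_p} {V} :
  mx_value x M V -> mx_value x (\adj M) (\adj V).
Proof.
move=> hM i j; rewrite !mxE; apply: has_valueM; first exact: has_value_sign.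
by apply: has_value_det => k l; rewrite !mxE.
Qed.

(** By Cramer's rule w *m M *m adj M = det M w, where det M has a nonzero
    value. *)
Lemma mx_value_unit_cancel {x p q} {w : 'M_(p, q)} {M : 'M_q} {V} :
  mx_value x M V -> V \in unitmx -> mx_value x (w *m M) 0 -> mx_value x w 0.
Proof.
move=> hM; rewrite unitmxE unitfE => dV0 hw.
have hd := has_value_det hM.
have dM0 : \det M != 0.
  apply: contraNneq dV0 => dM0; rewrite dM0 in hd.
  by rewrite (has_value_unique hd (has_value0 x)).
have := mx_valueZ (has_valueV dV0 hd) (mx_valueM hw (mx_value_adj hM)).
by rewrite -mulmxA mul_mx_adj mul_mx_scalar scalerA mulVf // scale1r mul0mx scaler0.
Qed.

(** * Null directions at a zero *)

(** The vector u may vary with lambda: where M has a pole, a constant vector need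
    not make u *m M bounded, let alone vanish. *)
Definition left_null x {p q} (M : 'M[{fraction {poly F}}]_(p, q)) : Prop :=
  exists (u : 'rV[{fraction {poly F}}]_p) (U : 'rV[F]_p),
    [/\ mx_value x u U, U != 0 & mx_value x (u *m M) 0].

Lemma regular_row_left_null {x p q} {M : 'M_(p, q)} {Ml Mr} (i : 'I_p) :
  regular_at x Ml -> regular_at x Mr ->
  mx_value x (row i (Ml *m M *m Mr)) 0 -> left_null x M.
Proof.
move=> [V hV uV] [W hW uW] h0; exists (row i Ml), (row i V); split.
- by move=> k l; rewrite !mxE; apply: hV.
- apply/eqP => rV0; have /rowP/(_ i) := congr1 (mulmx^~ (invmx V)) rV0.
  rewrite -row_mul mulmxV // mul0mx !mxE eqxx.
  by apply/eqP; rewrite oner_neq0.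
by apply: mx_value_unit_cancel hW uW _; rewrite -!row_mul.
Qed.

Lemma regular_at_tr {x p} {M : 'M_p} : regular_at x M -> regular_at x M^T.
Proof.
by move=> [V hV uV]; exists V^T; [move=> i j; rewrite !mxE | rewrite unitmx_tr].
Qed.

Lemma normal_rank_le_min {R : comNzRingType} {p q} (M : 'M[R]_(p, q)) :
  (normal_rank M <= minn p q)%N.
Proof. by apply/bigmax_leqP => k _; rewrite -ltnS. Qed.

Lemma has_zero_left_null {x p q} {N : 'M_(p, q)} :
  has_zero N x -> left_null x N.
Proof.
move=> [ds [[szds _ [Ml [Mr [hl hr eqN]]]] /(has_nthP 0)[i ids di]]].
have := ids; rewrite szds => /leq_trans /(_ (normal_rank_le_min N)).
rewrite leq_min => /andP[ip iq].
apply: (regular_row_left_null (Ordinal ip) hl hr) => k l; rewrite eqN !mxE /= ids andbT.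
case: ifP => _; [exact: has_value_local_parameter_exp | exact: has_value0].
Qed.

Lemma has_zero_right_null {x p q} {N : 'M_(p, q)} :
  has_zero N x -> left_null x N^T.
Proof.
move=> [ds [[szds _ [Ml [Mr [hl hr eqN]]]] /(has_nthP 0)[i ids di]]].
have := ids; rewrite szds => /leq_trans /(_ (normal_rank_le_min N)).
rewrite leq_min => /andP[ip iq].
apply: (regular_row_left_null (Ordinal iq) (regular_at_tr hr) (regular_at_tr hl)).
rewrite -trmx_mul -trmx_mul mulmxA eqN => k l; rewrite !mxE /=.
case: ifP => [/andP[/eqP-> _]|_]; last exact: has_value0.
exact: has_value_local_parameter_exp.
Qed.

(** * Extended pencils *)

(** Dividing by this makes polynomials of degree at most 1 bounded at x. *)
Definition grade1_denom x : {poly F} :=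
  match x with FinitePoint _ => 1 | InfinitePoint => 'X end.

Lemma homog_bound1 x a : (size a <= 2)%N -> homog_bound x 1 a.
Proof. by case: x. Qed.

Lemma has_value_grade1 x a : (size a <= 2)%N ->
  has_value x ((tofrac (grade1_denom x))^-1 * tofrac a) (homog_eval x 1 a).
Proof.
move=> sza.
have szt : (size (grade1_denom x) <= 2)%N.
  by case: x => [z|] /=; rewrite ?size_poly1 ?size_polyX.
have et : homog_eval x 1 (grade1_denom x) = 1.
  by case: x {szt} => [z|] /=; rewrite ?hornerE ?coefX.
apply/has_valueP; exists 1%N, a, (grade1_denom x).
rewrite et divr1 oner_neq0 mulrC; split=> //; exact: homog_bound1.
Qed.

(** The scalar c is -1 for the first extended pencil and 1 for the transpose of
    the second one. *)
Lemma extended_no_left_null {d m k} (L : 'M[{poly F}]_(d + m, k)) (c : F) x :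
  c != 0 -> (forall i j, (size (L i j) <= 2)%N) ->
  row_free (map_mx (homog_eval x 1) (usubmx L)) ->
  ~ left_null x (to_rational (row_mx L (col_mx 0 (c%:P)%:M : 'M_(d + m, m)))).
Proof.
move=> c0 szL freeN [u [U [hu U0 hM]]].
have valL : mx_value x ((tofrac (grade1_denom x))^-1 *: to_rational L)
                       (map_mx (homog_eval x 1) L).
  by move=> i j; rewrite !mxE; apply: has_value_grade1.
rewrite /to_rational map_row_mx map_col_mx raddf0 map_scalar_mx mul_mx_row in hM.
have hL : mx_value x (u *m to_rational L) 0.
  by move=> i j; have := hM i (lshift m j); rewrite row_mxEl !mxE.
have hr : mx_value x (tofrac c%:P *: rsubmx u) 0.
  move=> i j; have := hM i (rshift k j); rewrite row_mxEr.
  by rewrite -{1}[u]hsubmxK mul_row_col mulmx0 add0r mul_mx_scalar !mxE.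
have U2 : rsubmx U = 0.
  have hu2 : mx_value x (rsubmx u) (rsubmx U) by move=> i j; rewrite !mxE.
  have /eqP := mx_value_unique (mx_valueZ (has_valueC x c) hu2) hr.
  by rewrite scaler_eq0 (negPf c0) => /eqP.
(* 1 / grade1_denom x is bounded at x, so dividing by grade1_denom x preserves
   the limit 0 of u *m L *)
have szone : (size (1%R : {poly F}) <= 2)%N by rewrite size_poly1.
have h1 := mx_valueZ (has_value_grade1 x 1 szone) hL.
rewrite tofrac1 mulr1 scaler0 scalemxAr in h1.
have UL0 := mx_value_unique (mx_valueM hu valL) h1.
case/negP: U0; rewrite -[U]hsubmxK U2.
suff -> : lsubmx U = 0 by rewrite row_mx0.
apply: (row_free_inj freeN); rewrite mul0mx -UL0 -{2}[U]hsubmxK U2.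
by rewrite -{2}[L]vsubmxK map_col_mx mul_row_col mul0mx addr0.
Qed.

(** * Rank conditions from strong minimality *)

Lemma leq_normal_rank {R : comNzRingType} {p q k} {M : 'M[R]_(p, q)}
    (f : 'I_k -> 'I_p) (g : 'I_k -> 'I_q) :
  (k <= minn p q)%N -> \det (mxsub f g M) != 0 -> (k <= normal_rank M)%N.
Proof.
rewrite -ltnS => hk dM0; apply: (bigmax_sup (Ordinal hk)) => //.
apply/existsP; exists (finfun f); apply/existsP; exists (finfun g).
suff -> : mxsub (finfun f) (finfun g) M = mxsub f g M by [].
by apply/matrixP => i j; rewrite !mxE !ffunE.
Qed.

(** The rank at infinity is that of the coefficient of lambda, because it is the
    value at 0 of the reversal. *)
Lemma no_eigenvalues_rank {p q k} {P : 'M[{poly F}]_(p, q)} x :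
  no_eigenvalues P -> (k <= normal_rank P)%N ->
  (k <= normal_rank (reversal1 P))%N -> (k <= \rank (map_mx (homog_eval x 1) P))%N.
Proof.
move=> [Pfin Pinf] hk hrev; case: x => [z|].
  by apply: leq_trans hk _; rewrite leqNgt; apply/negP/Pfin.
apply: leq_trans hrev _; rewrite leqNgt; apply/negP => lt_rk; apply: Pinf.
congr (_ < _)%N: lt_rk; congr (\rank _); apply/matrixP => i j.
by rewrite !mxE /= /horner_eval !hornerE.
Qed.

End Values.

(** The value of the reversal at 1/z is P(z) / z, for every nonzero z.  As the
    field is infinite, some nonzero z is not a root of det P. *)
Lemma reversal1_det_neq0 {F : numFieldType} {d} {P : 'M[{poly F}]_d} :
  (forall i j, (size (P i j) <= 2)%N) -> \det P != 0 -> \det (reversal1 P) != 0.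
Proof.
move=> szP dP0.
have [z /andP[z0 dPz]] : exists z : F, (z != 0) && ~~ root (\det P) z.
  pose s := [seq i.+1%:R | i <- iota 0 (size (\det P))] : seq F.
  have us : uniq s.
    rewrite map_inj_uniq ?iota_uniq // => i j /eqP.
    by rewrite Num.Theory.eqr_nat => /eqP[].
  have [allr | /allPn[z /mapP[i _ ->] nr]] := boolP (all (root (\det P)) s).
    by have := max_poly_roots dP0 allr us; rewrite size_map size_iota ltnn.
  by exists i.+1%:R; rewrite Num.Theory.pnatr_eq0.
apply: contraNneq dPz => dr0; rewrite /root -[_.[z]]/(horner_eval z _) -det_map_mx.
have -> : map_mx (horner_eval z) P = z *: map_mx (horner_eval z^-1) (reversal1 P).
  apply/matrixP => i j; rewrite !mxE /horner_eval !hornerE mulrDr mulrCA divff //.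
  rewrite (@horner_coef_wide _ 2) // !big_ord_recl big_ord0 !expr0.
  by rewrite !mulr1 addr0 addrC mulrC.
by rewrite detZ det_map_mx dr0 rmorph0 mulr0.
Qed.

Lemma size_pencil {F : fieldType} {p q} (P1 P0 : 'M[F]_(p, q)) i j :
  (size (pencil P1 P0 i j) <= 2)%N.
Proof.
rewrite !mxE -polyCN; apply: leq_trans (size_polyD _ _) _.
rewrite geq_max (leq_trans (size_polyC_leq1 _)) // andbT mulrC.
by rewrite mul_polyC (leq_trans (size_scale_leq _ _)) ?size_polyX.
Qed.

Lemma size_linear_system_matrix {F : fieldType} {d m n}
    {A0 A1 : 'M[F]_d} {B0 B1 : 'M[F]_(d, n)} {C0 C1 : 'M[F]_(m, d)}
    {D0 D1 : 'M[F]_(m, n)} i j :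
  (size (linear_system_matrix A0 A1 B0 B1 C0 C1 D0 D1 i j) <= 2)%N.
Proof.
rewrite /linear_system_matrix -(splitK i) -(splitK j).
case: (split i) => i'; case: (split j) => j' /=;
  rewrite (block_mxEul, block_mxEur, block_mxEdl, block_mxEdr).
all: rewrite ?[(- pencil _ _) _ _]mxE ?size_polyN; exact: size_pencil.
Qed.

Theorem proposition1 (R : realType) (d m n : nat)
    (A0 A1 : 'M[complex R]_d)
    (B0 B1 : 'M[complex R]_(d, n))
    (C0 C1 : 'M[complex R]_(m, d))
    (D0 D1 : 'M[complex R]_(m, n)) :
  regular_pencil (pencil A1 A0) ->
  strongly_minimal (linear_system_matrix A0 A1 B0 B1 C0 C1 D0 D1) ->
  strongly_irreducible (linear_system_matrix A0 A1 B0 B1 C0 C1 D0 D1).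
Proof.
move=> regA; set L := linear_system_matrix _ _ _ _ _ _ _ _.
have szL : forall i j, (size (L i j) <= 2)%N by exact: size_linear_system_matrix.
have revA : \det (reversal1 (pencil A1 A0)) != 0.
  by apply: reversal1_det_neq0 regA => i j; apply: size_pencil.
have dB : (d <= minn d (d + n))%N by rewrite leq_min leqnn leq_addr.
have dC : (d <= minn (d + m) d)%N by rewrite leq_min leqnn leq_addr.
have subB : mxsub id (lshift n) (usubmx L) = pencil A1 A0.
  by apply/matrixP => i j; rewrite mxE mxE block_mxEul.
have subC : mxsub (lshift m) id (lsubmx L) = pencil A1 A0.
  by apply/matrixP => i j; rewrite mxE mxE block_mxEul.
move=> [minB minC]; split=> x.
- move/has_zero_left_null; rewrite -scaleN1r scale_scalar_mx mulr1 -polyC1 -polyCN.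
  apply: extended_no_left_null => //; first by rewrite oppr_eq0 oner_neq0.
  rewrite -row_leq_rank; apply: no_eigenvalues_rank minB _ _.
    by apply: (leq_normal_rank id (lshift n)); rewrite ?subB.
  by apply: (leq_normal_rank id (lshift n)); rewrite // -map_mxsub subB.
- move/has_zero_right_null.
  rewrite /to_rational matrix.map_trmx tr_col_mx tr_row_mx trmx0 trmx1 -polyC1.
  apply: extended_no_left_null => [||]; first by rewrite oner_neq0.
    by move=> i j; rewrite mxE.
  rewrite -trmx_lsub -matrix.map_trmx -row_leq_rank mxrank_tr.
  apply: no_eigenvalues_rank minC _ _.
    by apply: (leq_normal_rank (lshift m) id); rewrite ?subC.
  by apply: (leq_normal_rank (lshift m) id); rewrite // -map_mxsub subC.
Qed.
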